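(* Let $F$, $\Omega$, $\bar y$, $\{e^k\}$, $\{\lambda_k\}$, $\hat x$ be as in the setting of the context, let $\{x^k\}$ be any sequence generated from $x^0=\hat x$ by $$x^{k+1}\in \mathrm{argmin}_w\left\{F(x)+\frac{\lambda_k}{2}\|x-x^k\|^2e^k : x\in\Omega_k\right\},\qquad \Omega_k:=\{x\in\mathbb{R}^n: F(x)\preceq F(x^k)\},\qquad k=0,1,\dots,$$ and suppose that $\Omega_k$ is convex for each $k$. Assume that: (H1) $\{y\in\mathbb{R}^n: F(y)\preceq F(x^k),\ k=0,1,\dots\}\ne\varnothing$; (H2) there exists $c\in\mathbb{R}$ such that, with $e:=(1,\dots,1)\in\mathbb{R}^m$ and $S_F(ce):=\{x\in\mathbb{R}^n: F(x)\preceq ce\}$: (a) $S_F(ce)\neq\varnothing$ and $S_F(ce)\subsetneq S_F(F(\bar y))$; (b) $S_F(ce)$ is convex and $F$ is convex on $S_F(ce)$; (H3) for this $c$, there exists $\delta>0$ such that for all $z\in\mathbb{R}^m_+$ with $\|z\|=1$, all $x\in S_F(F(\bar y))\setminus S_F(ce)$, all $k=0,1,\dots$ and all $w\in\partial^\circ(\langle F(\cdot),z\rangle)(x)+N_{\Omega_k}(x)$, it holds that $\|w\|>\delta$. Then $\{x^k\}$ converges to a point $x^*\in U^*$, where $U^*$ is the set of weak Pareto solutions of $F$ on $\mathbb{R}^n$.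
   Context: Setting: $n,m\ge1$, $I:=\{1,\dots,m\}$, $\Omega\subset\mathbb{R}^n$ is open and convex. $F:\mathbb{R}^n\to\mathbb{R}^m$, $F=(f_1,\dots,f_m)$, where $f_j(x):=\max_{i\in I_j}f_{ij}(x)$, $I_j:=\{1,\dots,\ell_j\}$ with $\ell_j$ a positive integer, and each $f_{ij}:\mathbb{R}^n\to\mathbb{R}$ is continuously differentiable on $\Omega$ and continuous on $\bar\Omega$. For all $j\in I$: $-\infty<\inf_{x\in\mathbb{R}^n}f_j(x)$, and $\mathrm{grad} f_{ij}$ is Lipschitz on $\Omega$ with constant $L_{ij}$ for each $i\in I_j$. The point $\bar y\in\mathbb{R}^n$ is such that $S_F(F(\bar y)):=\{x\in\mathbb{R}^n:F(x)\preceq F(\bar y)\}\subset\Omega$. Fix $\bar\lambda>0$, $0<\bar\mu<1$; $\{e^k\}\subset\mathbb{R}^m_{++}$ and $\{\lambda_k\}\subset\mathbb{R}_{++}$ satisfy $\|e^k\|=1$, $\bar\mu<e^k_j$, and $\frac1{\bar\mu}\max_{i\in I_j}L_{ij}<\lambda_k\le\bar\lambda$ for all $j\in I$, $k=0,1,\dots$. The starting point satisfies $\hat x\in S_F(F(\bar y))$. Notation: $\|\cdot\|$ is the Euclidean norm. $\mathbb{R}^m_+$, $\mathbb{R}^m_{++}$ are the vectors with all coordinates $\ge0$, respectively $>0$; $y\preceq z$ means $z-y\in\mathbb{R}^m_+$, $y\prec z$ means $z-y\in\mathbb{R}^m_{++}$. For nonempty $C\subset\mathbb{R}^n$ and $G:\mathbb{R}^n\to\mathbb{R}^m$,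 $\mathrm{argmin}_w\{G(x):x\in C\}$ is the set of weak Pareto solutions: points $x^*\in C$ for which there is no $x\in C$ with $G(x)\prec G(x^* )$; $U^*$ is this set for $G=F$, $C=\mathbb{R}^n$. $F$ is convex on a convex set $C$ if $F((1-t)x+ty)\preceq(1-t)F(x)+tF(y)$ for all $x,y\in C$, $t\in[0,1]$. For a nonempty closed convex $C$, $N_C(x):=\{v\in\mathbb{R}^n:\langle v,y-x\rangle\le0,\ y\in C\}$. For $f:\mathbb{R}^n\to\mathbb{R}$ locally Lipschitz at $x$, $f^\circ(x,d):=\limsup_{t\downarrow0,\ y\to x}\frac{f(y+td)-f(y)}{t}$ and the Clarke subdifferential is $\partial^\circ f(x):=\{w\in\mathbb{R}^n:\langle w,d\rangle\le f^\circ(x,d)\ \forall d\in\mathbb{R}^n\}$. *)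

(* Defs.v *)
From mathcomp Require Import all_boot all_order all_algebra.
From mathcomp Require Import all_classical all_reals all_analysis.
Import Order.TTheory GRing.Theory Num.Theory.
Import numFieldNormedType.Exports.

Set Implicit Arguments.
Unset Strict Implicit.
Unset Printing Implicit Defensive.

Local Open Scope classical_set_scope.
Local Open Scope ring_scope.

(* The library norm [`|u|] on ['rV[R]_n] is the sup norm, so the Euclidean
   inner product and norm are introduced here.  Both norms induce the library
   topology of ['rV[R]_n]. *)
Definition dot (R : realType) (n : nat) (u v : 'rV[R]_n) : R :=
  \sum_i u 0 i * v 0 i.

Definition enorm (R : realType) (n : nat) (u : 'rV[R]_n) : R :=
  Num.sqrt (dot u u).

Definition nonneg_orthant (R : realType) (m : nat) : set 'rV[R]_m :=
  [set u | forall j, 0 <= u 0 j].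

Definition pos_orthant (R : realType) (m : nat) : set 'rV[R]_m :=
  [set u | forall j, 0 < u 0 j].

Definition vle (R : realType) (m : nat) (y z : 'rV[R]_m) : Prop :=
  nonneg_orthant (z - y).

Definition vlt (R : realType) (m : nat) (y z : 'rV[R]_m) : Prop :=
  pos_orthant (z - y).

(* Maximum of the nonempty family a_0, ..., a_p; starting the iteration from
   a_0 avoids an artificial neutral element. *)
Definition finmax (R : realType) (p : nat) (a : 'I_p.+1 -> R) : R :=
  \big[Num.max/a ord0]_(i < p.+1) a i.

Definition grad (R : realType) (n : nat) (f : 'rV[R]_n -> R) (x : 'rV[R]_n) :
    'rV[R]_n :=
  \row_i 'D_(delta_mx 0 i) f x.

Definition C1_on (R : realType) (n : nat) (D : set 'rV[R]_n)
    (f : 'rV[R]_n -> R) : Prop :=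
  (forall x, D x -> differentiable f x) /\ {within D, continuous (grad f)}.

Definition elipschitz_on (R : realType) (n m : nat) (D : set 'rV[R]_n) (L : R)
    (g : 'rV[R]_n -> 'rV[R]_m) : Prop :=
  forall x y, D x -> D y -> enorm (g x - g y) <= L * enorm (x - y).

Definition sublevel (R : realType) (n m : nat) (F : 'rV[R]_n -> 'rV[R]_m)
    (y : 'rV[R]_m) : set 'rV[R]_n :=
  [set x | vle (F x) y].

Definition weak_argmin (R : realType) (n m : nat) (G : 'rV[R]_n -> 'rV[R]_m)
    (C : set 'rV[R]_n) : set 'rV[R]_n :=
  [set x | C x /\ ~ exists2 y, C y & vlt (G y) (G x)].

Definition vconvex_on (R : realType) (n m : nat) (C : set 'rV[R]_n)
    (F : 'rV[R]_n -> 'rV[R]_m) : Prop :=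
  forall x y (t : R), C x -> C y -> 0 <= t <= 1 ->
    vle (F ((1 - t) *: x + t *: y)) ((1 - t) *: F x + t *: F y).

(* The point x is not required to belong to C. *)
Definition normal_cone (R : realType) (n : nat) (C : set 'rV[R]_n)
    (x : 'rV[R]_n) : set 'rV[R]_n :=
  [set v | forall y, C y -> dot v (y - x) <= 0].

(* The upper limit is taken over pairs (t, y), jointly as t decreases to 0
   and y tends to x. *)
Definition clarke_dderiv (R : realType) (n : nat) (f : 'rV[R]_n -> R)
    (x d : 'rV[R]_n) : \bar R :=
  limf_esup
    (fun ty : R * 'rV[R]_n => ((f (ty.2 + ty.1 *: d) - f ty.2) / ty.1)%:E)
    (filter_prod 0^'+ (nbhs x)).

Definition clarke_subdiff (R : realType) (n : nat) (f : 'rV[R]_n -> R)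
    (x : 'rV[R]_n) : set 'rV[R]_n :=
  [set w | forall d, ((dot w d)%:E <= clarke_dderiv f x d)%E].

(* Main.v *)
Require Import Defs.
From mathcomp Require Import all_boot all_order all_algebra.
From mathcomp Require Import all_classical all_reals all_analysis.
From mathcomp Require Import ring lra.
Import Order.TTheory GRing.Theory Num.Theory.
Import numFieldNormedType.Exports.

Set Implicit Arguments.
Unset Strict Implicit.
Unset Printing Implicit Defensive.

Local Open Scope classical_set_scope.
Local Open Scope ring_scope.

(** Write [S] for the sublevel set of [F (ybar)], [S_c] for the sublevel set of
    the constant vector [c], and [C_k] for the sublevel set of [F (x_k)]. The
    sets [C_k] are convex, nested and contained in [S].

    The iterates reach [S_c] after finitely many steps. On [Omega] the
    components of [F] are finite maxima of differentiable functions, so a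
    theorem of the alternative for finitely many convex functions yields Fritz
    John multipliers at the weak minimizer [x_(k+1)]: there is [z >= 0] with
    [|z| = 1] such that [- lambda_k <e_k, z> (x_(k+1) - x_k)] is the sum of a
    Clarke subgradient of [<F, z>] and of a normal to [C_k] at [x_(k+1)]
    (weak_argmin_prox_subgradient). Outside [S_c] such sums have norm larger
    than [delta], so [delta < lambda_k |x_(k+1) - x_k|] if [x_(k+1)] is outside
    [S_c]. As [x_(k+1)] is not strictly dominated by [x_k] in the regularized
    problem, some component of [F] then drops by at least [mubar delta^2 / (2
    lambdabar)] while the others do not increase. The sum of the components is
    bounded below, so this happens finitely often.

    From then on [C_k] is contained in [S_c], where [F] is convex. Moving from
    [x_(k+1)] slightly towards a point [y] with [F y <= F (x_(k+1)) - eps]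
    shows [eps <= lambda_k <x_(k+1) - x_k, y - x_(k+1)>] (convex_prox_descent),
    hence [|x_(k+1) - y|^2 <= |x_k - y|^2 - 2 eps / lambdabar] whenever [F y <=
    F (x_k)] for all [k]. With [eps = 0] the sequence is Fejer monotone with
    respect to the set of these [y], which is nonempty and contains every
    cluster point because the pieces are continuous on the closure of [Omega];
    hence it converges to a point of it (fejer_cvg). If [y] strictly dominated
    the limit, the same inequality would hold for some fixed [eps > 0] and all
    large [k], and the squared distances to [y] would become negative. *)

(** * A theorem of the alternative for convex functions *)

(** Convexity of a set, with points of segments written [a + t (b - a)] and a
    parameter [t] that is a plain real number. *)
Definition seg_closed (R : realType) (V : lmodType R) (C : set V) : Prop :=
  forall a b (t : R), C a -> C b -> 0 <= t <= 1 -> C (a + t *: (b - a)).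

(** Convexity of a function on [C], along the same parametrization. *)
Definition seg_convex (R : realType) (V : lmodType R) (C : set V)
    (h : V -> R) : Prop :=
  forall a b (t : R), C a -> C b -> 0 <= t <= 1 ->
    h (a + t *: (b - a)) <= (1 - t) * h a + t * h b.

Lemma convex_set_seg_closed (R : realType) (V : lmodType R) (C : set V) :
  @convex_set R V C -> seg_closed C.
Proof.
move=> cC a b t Ca Cb t01.
have := cC b a (@Itv01 R t (andP t01).1 (andP t01).2) (mem_set Cb) (mem_set Ca).
move/set_mem; congr C.
rewrite [LHS](_ : _ = t *: b + (1 - t) *: a) //.
rewrite scalerBr scalerBl scale1r addrC -!addrA; congr (_ + _).
by rewrite addrC.
Qed.

Lemma seg_convex_sum (R : realType) (V : lmodType R) (C : set V) (I : Type)
    (s : seq I) (b : I -> R) (h : I -> V -> R) :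
  (forall i, 0 <= b i) -> (forall i, seg_convex C (h i)) ->
  seg_convex C (fun d => \sum_(i <- s) b i * h i d).
Proof.
move=> b0 hc u v t Cu Cv t01; rewrite !mulr_sumr -big_split /=.
apply: ler_sum => i _; rewrite mulrCA [t * _]mulrCA -mulrDr.
by rewrite ler_wpM2l// hc.
Qed.

(** The multiplier is obtained from the infimum of [h d / - g d] over the points
    where [g] is negative. *)
Lemma convex_alternative2 (R : realType) (V : lmodType R) (D : set V)
    (g h : V -> R) :
  seg_closed D -> seg_convex D g -> seg_convex D h ->
  (forall d, D d -> g d < 0 -> h d < 0 -> False) ->
  exists2 c : R, 0 <= c <= 1 & forall d, D d -> 0 <= c * g d + (1 - c) * h d.
Proof.
move=> cD gc hc no.
have [[d0 Dd0 gd0]|nog] := pselect (exists2 d, D d & g d < 0); last first.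
  exists 1 => [|d Dd]; first by rewrite ler01 lexx.
  rewrite mul1r subrr mul0r addr0 leNgt; apply/negP => gd.
  by apply: nog; exists d.
have hge d : D d -> g d < 0 -> 0 <= h d.
  by move=> Dd gd; rewrite leNgt; apply/negP => /(no d Dd gd).
pose A := [set r | exists2 d, D d /\ g d < 0 & r = h d / - g d].
have lbA : lbound A 0.
  by move=> _ [d [Dd gd] ->]; rewrite divr_ge0 ?hge// oppr_ge0 ltW.
have hiA : has_inf A.
  by split; [exists (h d0 / - g d0); exists d0|exists 0].
pose s := inf A.
have s0 : 0 <= s by apply: lb_le_inf => //; case: hiA.
have sA d : D d -> g d < 0 -> s * - g d <= h d.
  move=> Dd gd; rewrite -ler_pdivlMr ?oppr_gt0//.
  by apply: ge_inf; [case: hiA|exists d].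
have key d : D d -> 0 <= s * g d + h d.
  move=> Dd; have [gd|gd] := ltP (g d) 0.
    by have := sA d Dd gd; rewrite mulrN; lra.
  have [hd|hd] := leP 0 (h d); first by rewrite addr_ge0// mulr_ge0.
  have cross d1 : D d1 -> g d1 < 0 -> h d * g d1 <= h d1 * g d.
    move=> Dd1 gd1; rewrite leNgt; apply/negP => lt.
    have h1 := hge _ Dd1 gd1.
    (* With weights w1 on d and w2 on d1, the values of g and those of h have
       the same combination h d1 * g d - h d * g d1, which is negative. *)
    pose w1 := h d1 - g d1; pose w2 := g d - h d.
    have w1p : 0 < w1 by rewrite /w1; lra.
    have w2p : 0 < w2 by rewrite /w2; lra.
    have wp : 0 < w1 + w2 by rewrite addr_gt0.
    have wn : w1 + w2 != 0 by rewrite gt_eqF.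
    pose t := w2 / (w1 + w2).
    have t01 : 0 <= t <= 1.
      rewrite /t divr_ge0 ?(ltW w2p) ?(ltW wp)//= ler_pdivrMr// mul1r.
      by rewrite lerDr ltW.
    have comb a b : (1 - t) * a + t * b = (w1 * a + w2 * b) / (w1 + w2).
      by rewrite /t; field.
    apply: (no (d + t *: (d1 - d))); first exact: cD.
    - apply: le_lt_trans (gc _ _ _ Dd Dd1 t01) _; rewrite comb.
      by rewrite pmulr_llt0 ?invr_gt0// /w1 /w2; lra.
    - apply: le_lt_trans (hc _ _ _ Dd Dd1 t01) _; rewrite comb.
      by rewrite pmulr_llt0 ?invr_gt0// /w1 /w2; lra.
  have gd' : 0 < g d.
    rewrite lt_neqAle gd andbT; apply/eqP => gd'.
    have := cross d0 Dd0 gd0; rewrite -gd' mulr0 leNgt => /negP; apply.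
    by rewrite nmulr_rgt0.
  rewrite -lerBlDr sub0r -ler_pdivrMr//.
  apply: lb_le_inf; first by case: hiA.
  move=> _ [d1 [Dd1 gd1] ->].
  rewrite ler_pdivlMr ?oppr_gt0// mulrAC ler_pdivrMr// mulrNN.
  exact: cross.
have s1 : 0 < 1 + s by lra.
exists (s / (1 + s)).
  by rewrite divr_ge0 ?(ltW s1)//= ler_pdivrMr// mul1r; lra.
move=> d Dd; have -> : s / (1 + s) * g d + (1 - s / (1 + s)) * h d =
  (s * g d + h d) / (1 + s) by field; rewrite gt_eqF.
by rewrite divr_ge0 ?key// ltW.
Qed.

(** The induction removes the function of index [a]: the others have no common
    negative point on the convex set where [h a < 0], so a combination of them
    is nonnegative there, and the case of two functions applies to this
    combination and to [h a]. *)
Lemma convex_alternative_seq (R : realType) (V : lmodType R) (I : eqType)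
    (h : I -> V -> R) (s : seq I) (a : I) (D : set V) :
  uniq (a :: s) -> seg_closed D -> (forall i, seg_convex D (h i)) ->
  ~ (exists2 d, D d & forall i, i \in a :: s -> h i d < 0) ->
  exists b : I -> R, [/\ forall i, 0 <= b i, \sum_(i <- a :: s) b i = 1 &
    forall d, D d -> 0 <= \sum_(i <- a :: s) b i * h i d].
Proof.
elim: s a D => [|a' s IH] a D.
  move=> _ cD hc no; exists (fun=> 1); split=> [//||d Dd].
    by rewrite big_seq1.
  rewrite big_seq1 mul1r leNgt; apply/negP => hd; apply: no; exists d => // i.
  by rewrite mem_seq1 => /eqP ->.
move=> /andP[an us] cD hc no.
pose D' := D `&` [set d | h a d < 0].
have cD' : seg_closed D'.
  move=> u v t [Du hu] [Dv hv] /[dup] t01 /andP[t0 t1]; split; first exact: cD.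
  apply: le_lt_trans (hc _ _ _ _ Du Dv t01) _.
  by rewrite /= in hu hv *; nra.
have [||b [b0 b1 bD']] := IH a' D' us cD'.
- by move=> i u v t [Du _] [Dv _]; exact: hc.
- move=> [d [Dd hd] ad]; apply: no; exists d => // i.
  by rewrite in_cons => /orP[/eqP -> //|]; exact: ad.
pose h' d := \sum_(i <- a' :: s) b i * h i d.
have [|d Dd h'd had|c /andP[c0 c1] cD1] := convex_alternative2 cD _ (hc a)
    (g := h').
- exact: seg_convex_sum.
- by have := bD' d (conj Dd had); rewrite leNgt h'd.
exists (fun i => if i == a then 1 - c else c * b i).
have ne i : i \in a' :: s -> (i == a) = false.
  by apply: contraTF => /eqP ->; rewrite an.
split => [i||d Dd].
- by case: ifP => _; [rewrite subr_ge0|rewrite mulr_ge0].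
- rewrite big_cons eqxx big_seq.
  under eq_bigr => i /ne -> do [].
  by rewrite -big_seq -mulr_sumr b1 mulr1 subrK.
- rewrite big_cons eqxx big_seq.
  under eq_bigr => i /ne -> do rewrite -mulrA.
  by rewrite -big_seq -mulr_sumr addrC cD1.
Qed.

(** Fan-Glicksberg-Hoffman: finitely many convex functions without a common
    point of negativity have a convex combination that is nonnegative. *)
Lemma convex_alternative (R : realType) (V : lmodType R) (I : finType)
    (i0 : I) (h : I -> V -> R) (D : set V) :
  seg_closed D -> (forall i, seg_convex D (h i)) ->
  ~ (exists2 d, D d & forall i, h i d < 0) ->
  exists b : I -> R, [/\ forall i, 0 <= b i, \sum_i b i = 1 &
    forall d, D d -> 0 <= \sum_i b i * h i d].
Proof.
move=> cD hc no.
have := mem_index_enum i0; have := index_enum_uniq I.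
have : forall i, i \in index_enum I by move=> i; exact: mem_index_enum.
case: (index_enum I) => [//|a s] als us _.
apply: convex_alternative_seq => // -[d Dd hd]; apply: no; exists d => // i.
by apply: hd.
Qed.

(** * The Euclidean inner product and norm *)

Section EuclideanSpace.
Context (R : realType) (n : nat).
Implicit Types u v w : 'rV[R]_n.

Lemma dotC u v : dot u v = dot v u.
Proof. by apply: eq_bigr => i _; rewrite mulrC. Qed.

Lemma dotDl u v w : dot (u + v) w = dot u w + dot v w.
Proof. by rewrite -big_split; apply: eq_bigr => i _; rewrite mxE mulrDl. Qed.

Lemma dotZl (a : R) u v : dot (a *: u) v = a * dot u v.
Proof. by rewrite mulr_sumr; apply: eq_bigr => i _; rewrite mxE mulrA. Qed.

Lemma dotNl u v : dot (- u) v = - dot u v.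
Proof. by rewrite -scaleN1r dotZl mulN1r. Qed.

Lemma dotDr u v w : dot u (v + w) = dot u v + dot u w.
Proof. by rewrite dotC dotDl !(dotC u). Qed.

Lemma dotZr (a : R) u v : dot u (a *: v) = a * dot u v.
Proof. by rewrite dotC dotZl (dotC u). Qed.

Lemma dotNr u v : dot u (- v) = - dot u v.
Proof. by rewrite dotC dotNl (dotC u). Qed.

Definition dotE := (dotDl, dotDr, dotZl, dotZr, dotNl, dotNr).

Lemma dot_suml (I : finType) (b : I -> R) (w : I -> 'rV[R]_n) v :
  dot (\sum_i b i *: w i) v = \sum_i b i * dot (w i) v.
Proof.
have dot0l : dot 0 v = 0 by apply: big1 => i _; rewrite mxE mul0r.
rewrite (big_morph (fun x => dot x v) (fun x y => dotDl x y v) dot0l).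
by apply: eq_bigr => i _; rewrite dotZl.
Qed.

Lemma dot_ge0 u : 0 <= dot u u.
Proof. by apply: sumr_ge0 => i _; rewrite -expr2 sqr_ge0. Qed.

Lemma enorm_ge0 u : 0 <= enorm u.
Proof. exact: sqrtr_ge0. Qed.

Lemma enorm_sqr u : enorm u ^+ 2 = dot u u.
Proof. by rewrite sqr_sqrtr// dot_ge0. Qed.

Lemma enormZ (a : R) u : enorm (a *: u) = `|a| * enorm u.
Proof.
by rewrite /enorm dotZl dotZr mulrA -expr2 sqrtrM ?sqr_ge0// sqrtr_sqr.
Qed.

Lemma coord_le_enorm u i : `|u 0 i| <= enorm u.
Proof.
rewrite -sqrtr_sqr ler_sqrt ?dot_ge0//.
rewrite /dot (bigD1 i) //= expr2 lerDl sumr_ge0// => k _.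
by rewrite -expr2 sqr_ge0.
Qed.

Lemma norm_le_enorm u : `|u| <= enorm u.
Proof.
rewrite /Num.norm/= mx_normrE; apply: bigmax_le => [|[i j] _ /=].
  exact: enorm_ge0.
by rewrite (ord1 i) coord_le_enorm.
Qed.

Lemma dot_le1 u v : enorm u = 1 -> enorm v = 1 -> dot u v <= 1.
Proof.
move=> u1 v1; have := dot_ge0 (u - v).
rewrite !dotE (dotC v u) -!enorm_sqr u1 v1 expr1n; lra.
Qed.

End EuclideanSpace.

(** * Directional derivatives, Clarke subgradients and multipliers *)

Section DirectionalDerivatives.
Context (R : realType) (n : nat).
Implicit Types u v d : 'rV[R]_n.

Lemma cvg_ray_quotient (f : 'rV[R]_n -> R) u d : differentiable f u ->
  (f (u + t *: d) - f u) / t @[t --> 0^'+] --> dot (grad f u) d.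
Proof.
move=> df.
have -> : dot (grad f u) d = 'D_d f u.
  rewrite deriveE// [in RHS](row_sum_delta d) linear_sum; apply: eq_bigr => i _.
  by rewrite linearZ mxE mulrC -deriveE.
have dfd : h^-1 *: ((f \o shift u) (h *: d) - f u) @[h --> 0^'] --> 'D_d f u.
  by exact: (diff_derivable df).
apply: cvg_trans (cvg_dnbhs_at_right dfd); apply: near_eq_cvg.
by near=> t; rewrite /= [_ + u]addrC; exact: mulrC.
Unshelve. all: by end_near.
Qed.

Lemma cvg_ray_quotient_sqr (a : R) (p u d : 'rV[R]_n) :
  (a / 2 * enorm (u + t *: d - p) ^+ 2 - a / 2 * enorm (u - p) ^+ 2) / t
    @[t --> 0^'+] --> a * dot (u - p) d.
Proof.
have E : \forall t \near (0 : R)^'+,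
    a * dot (u - p) d + a / 2 * dot d d * t =
    (a / 2 * enorm (u + t *: d - p) ^+ 2 - a / 2 * enorm (u - p) ^+ 2) / t.
  near=> t; have t0 : t != 0 by rewrite gt_eqF.
  by rewrite !enorm_sqr addrAC !dotE (dotC d u) (dotC d p); field.
apply: cvg_trans (near_eq_cvg E) _.
have -> : nbhs (a * dot (u - p) d) =
    nbhs (a * dot (u - p) d + a / 2 * dot d d * 0) by rewrite mulr0 addr0.
apply: cvgD; first exact: cvg_cst.
apply: cvgM; first exact: cvg_cst.
by apply: cvg_at_right_filter; exact: cvg_id.
Unshelve. all: by end_near. Qed.

(** Lower bounds on the difference quotients along rays issued from [u] itself
    suffice, because the upper limit that defines the Clarke derivative allows
    the base point to stay at [u]. *)
Lemma clarke_subdiff_ray (f : 'rV[R]_n -> R) u w :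
  (forall d (eps : R), 0 < eps -> \forall t \near 0^'+,
    dot w d - eps <= (f (u + t *: d) - f u) / t) ->
  clarke_subdiff f u w.
Proof.
move=> H d; rewrite /clarke_dderiv limf_esupE; apply/ereal_infP => _ [V FV <-].
case: FV => -[A B] /= [A0 Bu] AB.
apply/lee_subgt0Pr => eps eps0.
have [t [At Ht]] : exists t, A t /\ dot w d - eps <= (f (u + t *: d) - f u) / t.
  apply: (@filter_ex _ (0^'+ : set_system R)).
  by near=> t; split; near: t => //; exact: H.
apply: le_ereal_sup_tmp; exists ((f (u + t *: d) - f u) / t)%:E => //.
  exists (t, u) => //; apply: AB; split=> //=; exact: nbhs_singleton.
Unshelve. all: by end_near. Qed.

End DirectionalDerivatives.

(** First-order conditions at a point [u] of a convex set [C] where the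
    constraints [g i < b i] cannot be satisfied simultaneously; [v i] is the
    gradient of [g i] at [u]. *)
Lemma fritz_john_multipliers (R : realType) (n : nat) (I : finType) (i0 : I)
    (C : set 'rV[R]_n) (u : 'rV[R]_n) (g : I -> 'rV[R]_n -> R) (b : I -> R)
    (v : I -> 'rV[R]_n) :
  seg_closed C -> C u -> (forall i, g i u <= b i) ->
  (forall i d, (g i (u + t *: d) - g i u) / t @[t --> 0^'+] --> dot (v i) d) ->
  ~ (exists2 y, C y & forall i, g i y < b i) ->
  exists c : I -> R, [/\ forall i, 0 <= c i, \sum_i c i = 1,
    forall i, c i * (b i - g i u) = 0 &
    forall y, C y -> 0 <= \sum_i c i * dot (v i) (y - u)].
Proof.
move=> cC Cu gb gv no.
(* Subtracting the slack b i - g i u treats active and inactive constraints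
   alike, and yields complementary slackness by evaluating at y = u. *)
pose h i y := dot (v i) (y - u) - (b i - g i u).
have [i x y t _ _ _||c [c0 c1 cC0]] :=
    @convex_alternative R 'rV[R]_n I i0 h C cC.
- by rewrite /h !dotE; lra.
- move=> [y Cy hy]; apply: no.
  have [t [[t0 t1] gt]] : exists t : R, (0 < t /\ t <= 1) /\
      forall i, (g i (u + t *: (y - u)) - g i u) / t < b i - g i u.
    apply: (@filter_ex _ (0^'+ : set_system R)).
    near=> t; split; [split=> //|].
      by near: t; apply: nbhs_right_le.
    near: t; apply: filter_forall => i.
    by apply: (cvgr_lt _ (gv i _)); move: (hy i); rewrite /h; lra.
  exists (u + t *: (y - u)); first by apply: cC => //; rewrite (ltW t0).
  move=> i; move: (gt i) (gb i); rewrite ltr_pdivrMr// => gi bi.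
  have : (b i - g i u) * t <= b i - g i u by rewrite ler_piMr// subr_ge0.
  by lra.
have ch0 i : c i * (b i - g i u) = 0.
  have p j : 0 <= c j * (b j - g j u) by rewrite mulr_ge0// subr_ge0.
  have : \sum_j c j * (b j - g j u) <= 0.
    rewrite -oppr_ge0 -sumrN; have := cC0 u Cu; congr (_ <= _).
    apply: eq_bigr => j _; rewrite /h subrr.
    have -> : dot (v j) 0 = 0 by apply: big1 => k _; rewrite mxE mulr0.
    by rewrite sub0r mulrN.
  rewrite le_eqVlt ltNge sumr_ge0//= orbF psumr_eq0// => /allP/(_ i).
  by rewrite mem_index_enum => /(_ isT)/eqP.
exists c; split=> // y Cy; have := cC0 y Cy; congr (_ <= _).
by apply: eq_bigr => i _; rewrite /h mulrBr ch0 subr0.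
Unshelve. all: by end_near. Qed.

(** * Vector functions whose components are finite maxima *)

(** The pieces [f i] are indexed by a single finite type, [tau i] being the
    component to which the piece [f i] belongs. *)
Section MaxFunctions.
Context (R : realType) (n m : nat) (I : finType) (tau : I -> 'I_m).
Context (f : I -> 'rV[R]_n -> R) (F : 'rV[R]_n -> 'rV[R]_m).
Context (F_ub : forall i v, f i v <= F v 0 (tau i)).

Let dot_fibre (c : I -> R) (y : 'rV[R]_m) :
  dot y (\row_j \sum_(i | tau i == j) c i) = \sum_i c i * y 0 (tau i).
Proof.
rewrite [RHS](partition_big tau xpredT)//; apply: eq_bigr => j _.
rewrite mxE mulr_sumr; apply: eq_bigr => i /eqP ->; exact: mulrC.
Qed.

(** The complementarity condition says that only pieces active at [u] carry
    weight; the weights of the pieces of a component sum to the coefficient of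
    that component in the scalarization. *)
Lemma clarke_subdiff_scalarized_max (c : I -> R) (u : 'rV[R]_n) :
  (forall i, differentiable (f i) u) -> (forall i, 0 <= c i) ->
  (forall i, c i * (F u 0 (tau i) - f i u) = 0) ->
  clarke_subdiff
    (fun v => dot (F v) (\row_j \sum_(i | tau i == j) c i)) u
    (\sum_i c i *: grad (f i) u).
Proof.
move=> df c0 compl; apply: clarke_subdiff_ray => d eps eps0.
have cvg_sum : \sum_i c i * ((f i (u + t *: d) - f i u) / t) @[t --> 0^'+] -->
    \sum_i c i * dot (grad (f i) u) d.
  apply: cvg_big => [|i _]; first exact: add_continuous.
  apply: cvgM; first exact: cvg_cst.
  exact: cvg_ray_quotient.
near=> t; have t0 : 0 < t by [].
apply: (@le_trans _ _ (\sum_i c i * ((f i (u + t *: d) - f i u) / t))).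
  rewrite dot_suml ltW//; near: t; apply: (cvgr_gt _ cvg_sum).
  by rewrite ltrBlDr ltrDl.
rewrite !dot_fibre -sumrB mulr_suml; apply: ler_sum => i _.
rewrite mulrA -mulrBr; apply: ler_wpM2r; first by rewrite invr_ge0 ltW.
have : c i * f i (u + t *: d) <= c i * F (u + t *: d) 0 (tau i).
  by rewrite ler_wpM2l.
have := compl i; rewrite !mulrBr; lra.
Unshelve. all: by end_near. Qed.

(** First-order optimality condition of the proximal step: the subgradient of
    the quadratic term, up to sign, is a Clarke subgradient of a scalarization
    of [F] plus a normal vector to [C]. *)
Lemma weak_argmin_prox_subgradient (C : set 'rV[R]_n) (a u : 'rV[R]_n)
    (e : 'rV[R]_m) (lambda : R) : (0 < m)%N ->
  (forall v j, exists2 i, tau i = j & F v 0 j = f i v) ->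
  seg_closed C -> (forall i, differentiable (f i) u) ->
  weak_argmin (fun v => F v + (lambda / 2 * enorm (v - a) ^+ 2) *: e) C u ->
  exists z : 'rV[R]_m, [/\ nonneg_orthant z, enorm z = 1 &
    [set s + w | s in clarke_subdiff (fun v => dot (F v) z) u
               & w in normal_cone C u] (- (lambda * dot e z) *: (u - a))].
Proof.
move=> m_gt0 F_att cC df [Cu no].
have [i0 _ _] := F_att u (Ordinal m_gt0).
pose g i v := f i v + lambda * e 0 (tau i) / 2 * enorm (v - a) ^+ 2.
pose b i := F u 0 (tau i) + lambda * e 0 (tau i) / 2 * enorm (u - a) ^+ 2.
pose v i : 'rV[R]_n := grad (f i) u + (lambda * e 0 (tau i)) *: (u - a).
have [i|i d /=|[y Cy gy]|c [c0 c1 compl cv]] :=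
    @fritz_john_multipliers R n I i0 C u g b v cC Cu.
- by rewrite lerD2r.
- have -> : dot (v i) d =
      dot (grad (f i) u) d + lambda * e 0 (tau i) * dot (u - a) d.
    by rewrite /v dotDl dotZl.
  have L := cvgD (cvg_ray_quotient (d := d) (df i))
    (@cvg_ray_quotient_sqr R n (lambda * e 0 (tau i)) a u d).
  refine (cvg_trans _ (L _)); apply: near_eq_cvg.
  by near=> t; rewrite fctE /g -mulrDl; congr (_ / _); ring.
- apply: no; exists y => // j; have [i <- Fi] := F_att y j.
  by have := gy i; rewrite /g /b !mxE Fi; lra.
pose z0 : 'rV[R]_m := \row_j \sum_(i | tau i == j) c i.
have z0_ge0 j : 0 <= z0 0 j by rewrite mxE sumr_ge0.
have z0_gt0 : 0 < enorm z0.
  rewrite lt_neqAle enorm_ge0 andbT eq_sym; apply/eqP => z00.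
  have : dot (const_mx 1) z0 = 1.
    by rewrite dot_fibre -[RHS]c1; apply: eq_bigr => i _; rewrite mxE mulr1.
  suff -> : dot (const_mx 1) z0 = 0 by move/eqP; rewrite eq_sym oner_eq0.
  apply: big1 => j _; have := coord_le_enorm z0 j.
  by rewrite z00 normr_le0 => /eqP ->; rewrite mulr0.
pose c' i := (enorm z0)^-1 * c i.
pose z : 'rV[R]_m := \row_j \sum_(i | tau i == j) c' i.
have zE : z = (enorm z0)^-1 *: z0.
  by apply/rowP => j; rewrite !mxE mulr_sumr.
have c'0 i : 0 <= c' i by rewrite mulr_ge0// invr_ge0 enorm_ge0.
exists z; split.
- by move=> j; rewrite zE mxE mulr_ge0// invr_ge0 enorm_ge0.
- by rewrite zE enormZ ger0_norm ?invr_ge0 ?enorm_ge0// mulVf// gt_eqF.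
- exists (\sum_i c' i *: grad (f i) u).
    apply: clarke_subdiff_scalarized_max => // i.
    rewrite /c' -mulrA [X in _ * X](_ : _ = 0) ?mulr0// -[RHS](compl i).
    by congr (_ * _); rewrite /b /g; ring.
  exists (- \sum_i c' i *: v i).
    move=> y Cy; rewrite dotNl oppr_le0 dot_suml.
    under eq_bigr do rewrite -mulrA.
    by rewrite -mulr_sumr mulr_ge0 ?cv// invr_ge0 enorm_ge0.
  rewrite -sumrB dot_fibre mulr_sumr -sumrN scaler_suml.
  apply: eq_bigr => i _; rewrite /v scalerDr opprD addrA subrr sub0r scalerA.
  by rewrite -scaleNr; congr (- _ *: _); ring.
Unshelve. all: by end_near. Qed.

End MaxFunctions.

(** * Descent, Fejer monotonicity and cluster points *)

Lemma no_uniform_decrease (R : realType) (a : nat -> R) (B eta : R) :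
  0 < eta -> (forall k, B <= a k) -> (forall k, a k.+1 <= a k - eta) -> False.
Proof.
move=> eta0 aB da.
have ak k : a k <= a 0%N - eta * k%:R.
  elim: k => [|k IH]; first by rewrite mulr0 subr0.
  by rewrite -natr1 mulrDr mulr1; have := da k; lra.
have aB0 : 0 <= (a 0%N - B) / eta by rewrite divr_ge0 ?(ltW eta0)// subr_ge0.
have := archi_boundP aB0; set k := Num.bound _.
rewrite ltr_pdivrMr// (mulrC k%:R) => lt.
have Bak := le_trans (aB k) (ak k); lra.
Qed.

(** If the inequality failed, the point at a small distance from [u] towards [y]
    would strictly dominate [u] in the regularized problem. *)
Lemma convex_prox_descent (R : realType) (n m : nat) (C : set 'rV[R]_n)
    (F : 'rV[R]_n -> 'rV[R]_m) (a u y : 'rV[R]_n) (e : 'rV[R]_m)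
    (lambda eps : R) :
  seg_closed C -> vconvex_on C F -> 0 < lambda -> (forall j, 0 < e 0 j <= 1) ->
  weak_argmin (fun v => F v + (lambda / 2 * enorm (v - a) ^+ 2) *: e) C u ->
  C y -> 0 <= eps -> (forall j, F y 0 j <= F u 0 j - eps) ->
  eps <= lambda * dot (u - a) (y - u).
Proof.
move=> cC cF lambda0 e01 [Cu no] Cy eps0 Fy.
rewrite leNgt; apply/negP => lt; apply: no.
have [d dE] : exists d, d = y - u by exists (y - u).
rewrite -dE in lt *.
pose s := eps - lambda * dot (u - a) d.
have s0 : 0 < s by rewrite subr_gt0.
have q0 : 0 <= lambda * dot d d by rewrite mulr_ge0 ?dot_ge0 ?ltW.
(* The step t is small enough for the quadratic term lambda t^2 |d|^2 / 2 to
   stay below t * s. *)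
pose t := s / (s + lambda * dot d d).
have sq0 : 0 < s + lambda * dot d d by rewrite ltr_wpDr.
have t0 : 0 < t by rewrite divr_gt0.
have t1 : t <= 1 by rewrite ler_pdivrMr// mul1r lerDl.
have tq : t * (lambda * dot d d) <= s.
  rewrite /t mulrAC ler_pdivrMr// ler_wpM2l ?(ltW s0)//.
  by rewrite lerDr ltW.
have t01 : 0 <= t <= 1 by rewrite (ltW t0).
exists (u + t *: d); first by rewrite dE; exact: cC.
move=> j; rewrite !mxE subr_gt0.
have /andP[ej0 ej1] := e01 j.
have Ft : F (u + t *: d) 0 j <= F u 0 j - t * eps.
  have := cF u y t Cu Cy t01 j; rewrite !mxE.
  have -> : (1 - t) *: u + t *: y = u + t *: d.
    by rewrite dE scalerBl scalerBr scale1r addrA addrAC.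
  by have := Fy j; nra.
have -> : lambda / 2 * enorm (u + t *: d - a) ^+ 2 =
    lambda / 2 * enorm (u - a) ^+ 2 +
    t * (lambda * dot (u - a) d + t * (lambda * dot d d) / 2).
  by rewrite !enorm_sqr addrAC !dotE (dotC d u) (dotC d a); field.
set K := _ + t * _ / 2.
have K_lt : K < eps by rewrite /K; rewrite /s in tq s0; lra.
have : t * (K * e 0 j) < t * eps.
  rewrite ltr_pM2l//.
  apply: (@lt_le_trans _ _ (eps * e 0 j)); first by rewrite ltr_pM2r.
  by rewrite ler_piMr.
lra.
Qed.

Section EuclideanTopology.
Context (R : realType) (n : nat).
Implicit Types x u v : 'rV[R]_n.

Lemma nbhs_enorm u (eps : R) : 0 < eps ->
  \forall v \near u, enorm (v - u) < eps.
Proof.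
move=> eps0; pose c := Num.sqrt (n%:R : R) + 1.
have c0 : 0 < c by rewrite ltr_wpDl ?sqrtr_ge0.
apply/nbhs_normP; exists (eps / c); first by rewrite /= divr_gt0.
move=> v; rewrite /= distrC ltr_pdivlMr// => vu.
apply: le_lt_trans vu; rewrite mulrC.
apply: (@le_trans _ _ (Num.sqrt (n%:R : R) * `|v - u|)); last first.
  by rewrite ler_wpM2r// lerDl.
rewrite -[X in _ * X]ger0_norm// -sqrtr_sqr -sqrtrM//.
rewrite ler_sqrt ?mulr_ge0 ?sqr_ge0//.
rewrite -[n in n%:R]card_ord -sum1_card natr_sum mulr_suml.
apply: ler_sum => i _; rewrite mul1r -expr2 -real_normK ?num_real//.
rewrite ler_sqr ?nnegrE// /Num.norm/= mx_normrE.
exact: (le_bigmax _ (fun ij : 'I_1 * 'I_n => `|(v - u) ij.1 ij.2|) (0, i)).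
Qed.

(** The sequence is bounded, so it has a cluster point; the distance to that
    point is nonincreasing and has arbitrarily small values. *)
Lemma fejer_cvg (x : nat -> 'rV[R]_n) (E : set 'rV[R]_n) : E !=set0 ->
  (forall y, E y -> forall k, enorm (x k.+1 - y) <= enorm (x k - y)) ->
  (forall xs, cluster (x @ \oo) xs -> E xs) ->
  exists2 xs, E xs & x @ \oo --> xs.
Proof.
move=> [y0 Ey0] fejer clE.
have mono y : E y ->
    forall k l, (k <= l)%N -> enorm (x l - y) <= enorm (x k - y).
  move=> Ey k l /subnK <-; elim: (l - k)%N => [//|i IH].
  exact: le_trans (fejer y Ey _) IH.
pose r := enorm (x 0%N - y0).
have cA := @rV_compact R n (fun i => `[y0 0 i - r, y0 0 i + r]%classic)
  (fun i => @segment_compact _ _ _).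
have [|xs [_ clxs]] := cA (x @ \oo) _.
  exists 0%N => // k _ i /=.
  have := le_trans (coord_le_enorm _ i) (mono _ Ey0 _ _ (leq0n k)).
  by rewrite !mxE ler_norml in_itv /= /r => /andP[]; lra.
exists xs; first exact: clE.
apply/cvgrPdist_lt => eps eps0.
have rangex : (x @ \oo) (range x) by exists 0%N => // k _; exists k.
have [v [[k _ <-] /= xk]] := clxs _ _ rangex (nbhs_enorm xs eps0).
near=> l; rewrite distrC; apply: le_lt_trans (norm_le_enorm _) _.
apply: le_lt_trans xk; apply: mono; first exact: clE.
near: l; exact: nbhs_infty_ge.
Unshelve. all: by end_near. Qed.

Lemma cluster_within_le (A : set 'rV[R]_n) (f : 'rV[R]_n -> R)
    (x : nat -> 'rV[R]_n) xs (b : R) (K : nat) :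
  {within closure A, continuous f} -> (forall k, A (x k)) ->
  cluster (x @ \oo) xs -> (forall k, (K <= k)%N -> f (x k) <= b) ->
  f xs <= b.
Proof.
move=> cf Ax cl fb; rewrite leNgt; apply/negP => lt.
have tailA : (x @ \oo) [set v | A v /\ f v <= b].
  by exists K => // k /= Kk; split; [exact: Ax|exact: fb].
have clA : closure A xs.
  by move=> B nB; have [v [[Av _] Bv]] := cl _ _ tailA nB; exists v.
have := cf xs; rewrite /continuous_at => /cvgr_gt /(_ _ lt).
move=> nb0.
have nb : within (closure A) (nbhs xs) [set v | b < f v].
  by rewrite nbhs_subspace_in.
have [v [[Av fv] /= gtv]] := cl _ _ tailA nb.
by have := gtv (subset_closure Av); rewrite ltNge fv.
Qed.

End EuclideanTopology.

(** * Componentwise order, finite maxima and lower bounds *)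

Lemma vleP (R : realType) (m : nat) (y z : 'rV[R]_m) :
  vle y z <-> forall j, y 0 j <= z 0 j.
Proof. by split=> H j; have := H j; rewrite !mxE subr_ge0. Qed.

Lemma vltP (R : realType) (m : nat) (y z : 'rV[R]_m) :
  vlt y z <-> forall j, y 0 j < z 0 j.
Proof. by split=> H j; have := H j; rewrite !mxE subr_gt0. Qed.

Lemma finmax_ge (R : realType) (p : nat) (a : 'I_p.+1 -> R) i : a i <= finmax a.
Proof. exact: le_bigmax. Qed.

Lemma finmax_attained (R : realType) (p : nat) (a : 'I_p.+1 -> R) :
  exists i, finmax a = a i.
Proof.
apply: (big_ind (fun r => exists i, r = a i)) => [|_ _ [i ->] [k ->]|i _].
- by exists ord0.
- by case: (leP (a i) (a k)) => _; [exists k|exists i].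
- by exists i.
Qed.

Lemma ereal_inf_range_lbound (R : realType) (T : Type) (h : T -> R) (x0 : T) :
  (-oo < ereal_inf (range (fun x => (h x)%:E)))%E ->
  exists b, forall x, b <= h x.
Proof.
have lb x : (ereal_inf (range (fun x => (h x)%:E)) <= (h x)%:E)%E.
  by apply: ereal_inf_lbound; exists x.
case: ereal_inf lb => [b lb _|lb _|//].
  by exists b => x; rewrite -lee_fin.
by have := lb x0; rewrite leye_eq.
Qed.

(** * The proximal iterates *)

Section ProximalIterates.
Context (R : realType) (n m : nat) (F : 'rV[R]_n -> 'rV[R]_m).
Context (e : nat -> 'rV[R]_m) (lambda : nat -> R) (x : nat -> 'rV[R]_n).
Context (x_step : forall k,
  weak_argmin (fun u => F u + (lambda k / 2 * enorm (u - x k) ^+ 2) *: e k)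
    (sublevel F (F (x k))) (x k.+1)).

Lemma prox_iterates_le k l : (k <= l)%N -> vle (F (x l)) (F (x k)).
Proof.
move=> /subnK <-; elim: (l - k)%N => [|i IH].
  by apply/vleP => j.
apply/vleP => j; apply: le_trans ((vleP _ _).1 IH j).
have [+ _] := x_step (i + k)%N; move=> /vleP; exact.
Qed.

Lemma prox_step_decrease k : exists j,
  lambda k / 2 * enorm (x k.+1 - x k) ^+ 2 * e k 0 j <=
    F (x k) 0 j - F (x k.+1) 0 j.
Proof.
apply: contrapT => nj; have [_] := x_step k; apply; exists (x k).
  by apply/vleP.
apply/vltP => j; rewrite !mxE subrr enorm_sqr.
have -> : dot (0 : 'rV[R]_n) 0 = 0 by apply: big1 => i _; rewrite mxE mul0r.
rewrite mulr0 mul0r addr0 ltNge; apply/negP => le; apply: nj; exists j.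
lra.
Qed.

End ProximalIterates.

Theorem theorem3p2 (R : realType) (n m : nat) (n_gt0 : (0 < n)%N)
  (m_gt0 : (0 < m)%N)
  (Omega : set 'rV[R]_n) (Omega_open : open Omega)
  (Omega_convex : @convex_set R 'rV[R]_n Omega)
  (p : 'I_m -> nat)
  (f : forall j : 'I_m, 'I_(p j).+1 -> 'rV[R]_n -> R)
  (f_C1 : forall j i, C1_on Omega (f j i))
  (f_cont : forall j i, {within closure Omega, continuous (f j i)})
  (F : 'rV[R]_n -> 'rV[R]_m)
  (F_max : forall x j, F x 0 j = finmax (fun i => f j i x))
  (F_inf : forall j, (-oo < ereal_inf (range (fun x => (F x 0 j)%:E)))%E)
  (L : forall j : 'I_m, 'I_(p j).+1 -> R)
  (grad_lip : forall j i, elipschitz_on Omega (L j i) (grad (f j i)))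
  (ybar : 'rV[R]_n) (ybar_sub : sublevel F (F ybar) `<=` Omega)
  (lambdabar : R) (lambdabar_gt0 : 0 < lambdabar)
  (mubar : R) (mubar_gt0 : 0 < mubar) (mubar_lt1 : mubar < 1)
  (e : nat -> 'rV[R]_m) (lambda : nat -> R)
  (e_pos : forall k, pos_orthant (e k))
  (lambda_pos : forall k, 0 < lambda k)
  (e_norm : forall k, enorm (e k) = 1)
  (e_lb : forall k j, mubar < e k 0 j)
  (lambda_lb : forall k j, mubar^-1 * finmax (L j) < lambda k)
  (lambda_ub : forall k, lambda k <= lambdabar)
  (xhat : 'rV[R]_n) (xhat_mem : sublevel F (F ybar) xhat)
  (x : nat -> 'rV[R]_n) (x_init : x 0%N = xhat)
  (x_step : forall k,
    weak_argmin
      (fun u => F u + (lambda k / 2 * enorm (u - x k) ^+ 2) *: e k)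
      (sublevel F (F (x k))) (x k.+1))
  (Omegak_convex : forall k, @convex_set R 'rV[R]_n (sublevel F (F (x k))))
  (H1 : [set y | forall k, vle (F y) (F (x k))] !=set0)
  (H23 : exists c : R,
    let Sc := sublevel F (c *: const_mx 1) in
    [/\ Sc !=set0, Sc `<` sublevel F (F ybar),
        @convex_set R 'rV[R]_n Sc, vconvex_on Sc F &
        exists2 delta : R, 0 < delta &
          forall (z : 'rV[R]_m) (u : 'rV[R]_n) (k : nat) (w : 'rV[R]_n),
            nonneg_orthant z -> enorm z = 1 ->
            (sublevel F (F ybar) `\` Sc) u ->
            [set a + b | a in clarke_subdiff (fun v => dot (F v) z) u
                       & b in normal_cone (sublevel F (F (x k))) u] w ->
            delta < enorm w]) :
  exists2 xstar : 'rV[R]_n,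
    weak_argmin F [set: 'rV[R]_n] xstar & x @ \oo --> xstar.

Proof.
have [c [/= Sc_n0 _ _ F_convex [delta delta_gt0 H3]]] := H23.
set Sc := sublevel F _ in Sc_n0 F_convex H3.
pose I := {j : 'I_m & 'I_(p j).+1}.
pose tau (i : I) := tag i.
pose g (i : I) := f (tag i) (tagged i).
have F_ub i v : g i v <= F v 0 (tau i).
  by rewrite F_max; exact: (finmax_ge (fun k => f (tag i) k v)).
have F_att v j : exists2 i, tau i = j & F v 0 j = g i v.
  have [k kE] := finmax_attained (fun k => f j k v).
  by exists (Tagged (fun j => 'I_(p j).+1) k) => //; rewrite F_max kE.
have F_mono := prox_iterates_le x_step.
have x_S k : sublevel F (F ybar) (x k).
  apply/vleP => j; apply: le_trans ((vleP _ _).1 (F_mono _ _ (leq0n k)) j) _.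
  by rewrite x_init; exact: (vleP _ _).1 xhat_mem j.
have x_Omega k : Omega (x k) by exact: ybar_sub.
have e01 k j : 0 < e k 0 j <= 1.
  rewrite e_pos /= -(e_norm k).
  exact: le_trans (ler_norm _) (coord_le_enorm _ _).
have Ck_closed k := convex_set_seg_closed (@Omegak_convex k).
have long_step k : ~ Sc (x k.+1) ->
    delta < lambda k * enorm (x k.+1 - x k).
  move=> nSc.
  have [z [z_ge0 z_norm zsub]] := weak_argmin_prox_subgradient F_ub m_gt0 F_att
    (Ck_closed k) (fun i => (f_C1 (tag i) (tagged i)).1 _ (x_Omega k.+1))
    (x_step k).
  apply: lt_le_trans (H3 z (x k.+1) k _ z_ge0 z_norm _ zsub) _.
    by split; [exact: x_S|].
  have ez_ge0 : 0 <= dot (e k) z.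
    by apply: sumr_ge0 => j _; rewrite mulr_ge0// ltW// e_pos.
  rewrite enormZ normrN ger0_norm; last by rewrite mulr_ge0// ltW.
  rewrite ler_wpM2r ?enorm_ge0// ler_piMr ?(ltW (lambda_pos k))//.
  exact: dot_le1.
have [K xK] : exists K, Sc (x K).
  apply: contrapT => nSc.
  have [B FB] := fin_all_exists
    (fun j => ereal_inf_range_lbound ybar (F_inf j)).
  (* A step longer than delta / lambda_k lowers some component by at least
     eta. *)
  pose eta := mubar / 2 * (delta ^+ 2 / lambdabar).
  have eta_gt0 : 0 < eta by rewrite mulr_gt0// divr_gt0// exprn_gt0.
  apply: (@no_uniform_decrease R (fun k => \sum_j F (x k) 0 j) (\sum_j B j) eta)
    => // k; first by apply: ler_sum => j _.
  have [j dec] := prox_step_decrease x_step k.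
  have step : delta < lambda k * enorm (x k.+1 - x k).
    by apply: long_step => Sk; apply: nSc; exists k.+1.
  set s := enorm (x k.+1 - x k) in dec step.
  have s_ge0 : 0 <= s by exact: enorm_ge0.
  have eta_le : eta <= lambda k / 2 * s ^+ 2 * e k 0 j.
    apply: (@le_trans _ _ (lambda k / 2 * s ^+ 2 * mubar)); last first.
      apply: ler_wpM2l; last exact: ltW.
      by rewrite mulr_ge0 ?exprn_ge0// divr_ge0// ltW.
    suff : delta ^+ 2 / lambdabar <= lambda k * s ^+ 2 by rewrite /eta; nra.
    rewrite ler_pdivrMr//.
    apply: (@le_trans _ _ ((lambda k * s) ^+ 2)).
      by rewrite ler_sqr ?nnegrE ?(ltW delta_gt0) ?mulr_ge0 ?(ltW step)// ltW.
    have -> : (lambda k * s) ^+ 2 = lambda k * s ^+ 2 * lambda k by ring.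
    by rewrite ler_wpM2l// mulr_ge0 ?exprn_ge0// ltW.
  rewrite lerBrDl -lerBrDr -sumrB (bigD1 j)//=.
  apply: ler_wpDr; last exact: le_trans eta_le dec.
  apply: sumr_ge0 => i _; rewrite subr_ge0.
  by apply: (vleP _ _).1; exact: F_mono.
have x_Sc k : (K <= k)%N -> Sc (x k).
  move=> /F_mono /vleP le; apply/vleP => j; apply: le_trans (le j) _.
  exact: (vleP _ _).1 xK j.
pose E := [set y | forall k, vle (F y) (F (x k))].
(* Both the Fejer property (eps = 0) and the optimality of the limit
   (eps > 0) follow from this inequality. *)
have descent k y eps : (K <= k)%N -> E y -> 0 <= eps ->
    (forall j, F y 0 j <= F (x k.+1) 0 j - eps) ->
    lambdabar / 2 * enorm (x k.+1 - y) ^+ 2 <=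
      lambdabar / 2 * enorm (x k - y) ^+ 2 - eps.
  move=> Kk Ey eps_ge0 Fy.
  have Ck_Sc : sublevel F (F (x k)) `<=` Sc.
    move=> v /vleP le; apply/vleP => j; apply: le_trans (le j) _.
    exact: (vleP _ _).1 (x_Sc k Kk) j.
  have := @convex_prox_descent R n m _ F (x k) (x k.+1) y (e k) (lambda k) eps
    (Ck_closed k) _ (lambda_pos k) (e01 k) (x_step k) (Ey k) eps_ge0 Fy.
  move=> /(_ (fun u v t Cu Cv => F_convex u v t (Ck_Sc _ Cu) (Ck_Sc _ Cv))).
  set d := dot _ _ => dle.
  have d_ge0 : 0 <= d.
    by rewrite -(pmulr_rge0 _ (lambda_pos k)) (le_trans eps_ge0).
  have {}dle : eps <= lambdabar * d.
    by apply: le_trans dle _; rewrite ler_wpM2r.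
  have -> : enorm (x k - y) ^+ 2 = enorm (x k.+1 - y) ^+ 2 + 2 * d +
      enorm (x k.+1 - x k) ^+ 2.
    rewrite !enorm_sqr /d !dotE (dotC y (x k)) (dotC y (x k.+1)).
    by rewrite (dotC (x k.+1) (x k)); ring.
  have : 0 <= lambdabar / 2 * enorm (x k.+1 - x k) ^+ 2.
    by rewrite mulr_ge0 ?sqr_ge0// divr_ge0 ?(ltW lambdabar_gt0).
  lra.
(* The tail of the sequence, which lies in the set where F is convex. *)
pose x' l := x (l + K)%N.
have [||xs Exs x'_cvg] := @fejer_cvg R n x' E H1.
- move=> y Ey k; rewrite -ler_sqr ?nnegrE ?enorm_ge0//.
  have := descent (k + K)%N y 0 (leq_addl _ _) Ey (lexx _).
  rewrite subr0 ler_pM2l ?divr_gt0//; apply=> j; rewrite subr0.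
  exact: (vleP _ _).1 (Ey _) j.
- move=> xs xs_cl k; apply/vleP => j; have [i <- ->] := F_att xs j.
  apply: (@cluster_within_le R n Omega (g i) x' xs _ k) => //.
  + exact: f_cont.
  + by move=> l; exact: x_Omega.
  + move=> l kl; apply: le_trans (F_ub _ _) _.
    by apply: (vleP _ _).1; apply: F_mono; exact: leq_trans kl (leq_addr _ _).
exists xs; last by rewrite -(cvg_shiftn K).
split=> // -[y _ /vltP Fy].
have [eps [eps_gt0 Fy_eps]] :
    exists eps : R, 0 < eps /\ forall j, eps <= F xs 0 j - F y 0 j.
  apply: (@filter_ex _ (0^'+ : set_system R)).
  near=> r; split=> //; near: r; apply: filter_forall => j.
  by apply: nbhs_right_le; rewrite subr_gt0.
have Fy_k k j : F y 0 j <= F (x k) 0 j - eps.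
  by have := (vleP _ _).1 (Exs k) j; have := Fy_eps j; lra.
apply: (@no_uniform_decrease R
  (fun l => lambdabar / 2 * enorm (x' l - y) ^+ 2) 0 eps) => // l.
  by rewrite mulr_ge0 ?sqr_ge0// divr_ge0 ?(ltW lambdabar_gt0).
apply: (descent (l + K)%N) => //; first exact: leq_addl.
- by move=> k; apply/vleP => j; have := Fy_k k j; lra.
- exact: ltW.
Unshelve. all: by end_near. Qed.
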